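(* Let $d \ge 1$ and let $P \subseteq \mathbb{R}^d$ be a $d$-dimensional lattice polytope (i.e. all vertices of $P$ lie in $\mathbb{Z}^d$) such that every facet of $P$ is a simplex and the interior of $P$ contains no point of $\mathbb{Z}^d$. Then $P$ has at most $2^d$ vertices.
   Context: A polytope whose interior contains no lattice point is called hollow; a polytope all of whose facets are simplices is called simplicial. *)

(* Defs.v *)
From HB Require Import structures.
From mathcomp Require Import all_boot all_order all_algebra.
From mathcomp Require Import all_classical all_reals all_analysis.
Set Implicit Arguments. Unset Strict Implicit. Unset Printing Implicit Defensive.
Import Order.TTheory GRing.Theory Num.Theory numFieldTopology.Exports numFieldNormedType.Exports.
Local Open Scope ring_scope.
Local Open Scope classical_set_scope.

Section Polytopes.
Variables (R : realType) (d : nat).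
Implicit Types (V S : seq 'rV[R]_d) (x : 'rV[R]_d).

Definition conv V : set 'rV[R]_d :=
  [set x | exists lam : 'I_(size V) -> R,
      (forall i, 0 <= lam i) /\ \sum_i lam i = 1 /\
      x = \sum_i lam i *: V`_(val i)].

Definition affdim S : nat := \rank (\matrix_(i < size S) (S`_i - S`_0)).

Definition aff_indep S : Prop := S != [::] /\ affdim S = (size S).-1.

Definition dotp (a x : 'rV[R]_d) : R := \sum_(i < d) a 0 i * x 0 i.

Definition on_hyp (a : 'rV[R]_d) (b : R) V := [seq v <- V | dotp a v == b].

Definition facet_hyp (a : 'rV[R]_d) (b : R) V : Prop :=
  a != 0 /\ (forall v, v \in V -> dotp a v <= b) /\
  on_hyp a b V != [::] /\ affdim (on_hyp a b V) = d.-1.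

Definition is_vertex_list V : Prop :=
  uniq V /\ forall v, v \in V -> ~ conv (rem v V) v.

Definition full_dim V : Prop := V != [::] /\ affdim V = d.

Definition simplicial V : Prop :=
  forall a b, facet_hyp a b V -> aff_indep (on_hyp a b V).

Definition hollow V : Prop :=
  forall z : 'rV[int]_d, ~ (@interior 'rV[R]_d (conv V)) (map_mx intr z).

End Polytopes.

Definition lattice_pts (R : realType) (d : nat) (W : seq 'rV[int]_d) : seq 'rV[R]_d :=
  map (map_mx intr) W.

(* Main.v *)
Require Import Defs.
From HB Require Import structures.
From mathcomp Require Import all_boot all_order all_algebra.
From mathcomp Require Import all_classical all_reals all_analysis.
From mathcomp Require Import ring lra zify.

(** Attach to every vertex of P a lattice point of P, initially the vertex
    itself, so that for every facet F the attached points lying on F form an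
    affinely independent family; this holds initially because P is simplicial.
    If two attached points agree modulo 2, their midpoint m is a lattice point
    of P, hence lies on some facet since P is hollow, and that facet contains
    both points, which are therefore distinct. Replacing the longer of the two
    by m keeps the independence on every facet and decreases the sum of the
    squared lengths. So the process stops with a family of points that are
    pairwise incongruent modulo 2. *)

Set Implicit Arguments. Unset Strict Implicit. Unset Printing Implicit Defensive.
Import Order.TTheory GRing.Theory Num.Theory.
Import numFieldTopology.Exports numFieldNormedType.Exports.
Local Open Scope ring_scope.

(** * Inner products, Farkas' lemma and supporting hyperplanes *)

Section Farkas.
Variables (R : realType) (d : nat).
Implicit Types (a c x y : 'rV[R]_d).

Lemma dotpDr a x y : dotp a (x + y) = dotp a x + dotp a y.
Proof. by rewrite -big_split; apply: eq_bigr => i _; rewrite mxE mulrDr. Qed.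

Lemma dotpZr a k x : dotp a (k *: x) = k * dotp a x.
Proof. by rewrite mulr_sumr; apply: eq_bigr => i _; rewrite mxE mulrCA. Qed.

Lemma dotpC a x : dotp a x = dotp x a.
Proof. by apply: eq_bigr => i _; rewrite mulrC. Qed.

Lemma dotpDl a c x : dotp (a + c) x = dotp a x + dotp c x.
Proof. by rewrite ![dotp _ x]dotpC dotpDr. Qed.

Lemma dotpZl k a x : dotp (k *: a) x = k * dotp a x.
Proof. by rewrite ![dotp _ x]dotpC dotpZr. Qed.

Lemma dotpBr a x y : dotp a (x - y) = dotp a x - dotp a y.
Proof. by rewrite -scaleN1r dotpDr dotpZr mulN1r. Qed.

Lemma dotpNl a x : dotp (- a) x = - dotp a x.
Proof. by rewrite -scaleN1r dotpZl mulN1r. Qed.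

Lemma dotpBl a c x : dotp (a - c) x = dotp a x - dotp c x.
Proof. by rewrite dotpDl dotpNl. Qed.

Lemma dotp_sumr (I : Type) (r : seq I) (P : pred I) (F : I -> 'rV[R]_d) a :
  dotp a (\sum_(i <- r | P i) F i) = \sum_(i <- r | P i) dotp a (F i).
Proof.
apply: (big_morph _ (dotpDr a)).
by rewrite /dotp big1 // => i _; rewrite mxE mulr0.
Qed.

Lemma dotp_gt0 a : a != 0 -> 0 < dotp a a.
Proof.
move=> a0; rewrite lt_neqAle sumr_ge0 ?andbT => [|i _]; last first.
  by rewrite -expr2 sqr_ge0.
apply: contra_neq a0 => /esym/eqP; rewrite psumr_eq0 => [/allP h|i _].
  apply/rowP => i; have := h i (mem_index_enum i).
  by rewrite mulf_eq0 orbb mxE => /eqP.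
by rewrite -expr2 sqr_ge0.
Qed.

(** Induction on the number of generators. A functional [a] separating [y] from the cone of the
    others either is nonpositive on [u ord0] as well, or allows a projection that removes
    [u ord0]. *)
Lemma farkas n (u : 'I_n -> 'rV[R]_d) y :
  (exists2 l : 'I_n -> R, (forall i, 0 <= l i) & y = \sum_i l i *: u i) \/
  (exists2 a, (forall i, dotp a (u i) <= 0) & 0 < dotp a y).
Proof.
elim: n u y => [|n IHn] u y.
  have [->|y0] := eqVneq y 0; last by right; exists y => [[]//|]; exact: dotp_gt0.
  by left; exists (fun=> 0) => //; rewrite big_ord0.
have [[l l0 ->]|[a au ay]] := IHn (fun i => u (lift ord0 i)) y.
  left; exists (fun i => if unlift ord0 i is Some j then l j else 0) => [i|].
    by case: unlift.
  rewrite big_ord_recl unlift_none scale0r add0r.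
  by apply: eq_bigr => i _; rewrite liftK.
have [au0|au0] := leP (dotp a (u ord0)) 0.
  by right; exists a => // i; case: (unliftP ord0 i) => [j|] ->.
(* Project along [u ord0] onto the hyperplane orthogonal to [a]. *)
pose pr x : 'rV[R]_d := x - (dotp a x / dotp a (u ord0)) *: u ord0.
have [[l l0 ypr]|[c cu cy]] := IHn (fun i => pr (u (lift ord0 i))) (pr y).
  (* The weight of [u ord0] undoes the projections. It is nonnegative because [a] is positive on [y]
     and [u ord0] and nonpositive on the other generators. *)
  left; exists (fun i => if unlift ord0 i is Some j then l j else
    (dotp a y - \sum_j l j * dotp a (u (lift ord0 j))) / dotp a (u ord0)).
    move=> i; case: unlift => // ; rewrite divr_ge0 ?(ltW au0)// subr_ge0.
    apply: le_trans (ltW ay); apply: sumr_le0 => j _.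
    by rewrite mulr_ge0_le0.
  rewrite big_ord_recl unlift_none.
  rewrite (eq_bigr (fun i => l i *: u (lift ord0 i))) => [|i _]; last first.
    by rewrite liftK.
  have {ypr} : y = \sum_i l i *: pr (u (lift ord0 i)) +
      (dotp a y / dotp a (u ord0)) *: u ord0 by rewrite -ypr subrK.
  move=> {1}->; rewrite (eq_bigr (fun i => l i *: u (lift ord0 i) -
    (l i * dotp a (u (lift ord0 i)) / dotp a (u ord0)) *: u ord0)); last first.
    by move=> i _; rewrite scalerBr scalerA mulrA.
  rewrite sumrB -scaler_suml -mulr_suml mulrBl scalerBl.
  by rewrite addrC addrA; exact: addrAC.
(* [c - t *: a] represents the functional [c] composed with [pr], so it vanishes on [u ord0]. *)
right; pose t := dotp c (u ord0) / dotp a (u ord0).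
have E x : dotp (c - t *: a) x = dotp c (pr x).
  rewrite dotpBl dotpZl dotpBr dotpZr /t; congr (_ - _).
  by rewrite [LHS]mulrC mulrCA [RHS]mulrC.
exists (c - t *: a); last by rewrite E.
move=> i; case: (unliftP ord0 i) => [j|] ->; first by rewrite E.
by rewrite dotpBl dotpZl /t divfK ?subrr// gt_eqF.
Qed.

(* Otherwise Farkas puts every [delta_mx 0 k] and [- delta_mx 0 k] in the cone
   of the [v - x], so a small cube around [x] lies in the hull. *)
Lemma supporting_hyperplane (V : seq 'rV[R]_d) x :
  Defs.conv V x -> ~ interior (Defs.conv V) x ->
  exists2 a, a != 0 & forall v, v \in V -> dotp a v <= dotp a x.
Proof.
move=> [r [r0 [r1 xE]]] xNint; apply: contrapT => noa; apply: xNint.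
pose u (i : 'I_(size V)) := V`_i - x.
have cone y : exists2 l : 'I_(size V) -> R,
    (forall i, 0 <= l i) & y = \sum_i l i *: u i.
  have [//|[a au ay]] := farkas u y; case: noa; exists a.
    apply: contraTneq ay => ->; rewrite /dotp big1 ?ltxx// => i _.
    by rewrite mxE mul0r.
  move=> v vV; have iV : (index v V < size V)%N by rewrite index_mem.
  have := au (Ordinal iV); rewrite /u/= nth_index// dotpBr.
  by rewrite subr_le0.
have /choice[lp lpP] (k : 'I_d) : exists l : 'I_(size V) -> R,
    (forall i, 0 <= l i) /\ delta_mx 0 k = \sum_i l i *: u i.
  by have [l] := cone (delta_mx 0 k); exists l.
have /choice[lm lmP] (k : 'I_d) : exists l : 'I_(size V) -> R,
    (forall i, 0 <= l i) /\ - delta_mx 0 k = \sum_i l i *: u i.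
  by have [l] := cone (- delta_mx 0 k); exists l.
(* [C] is the total weight spent on all the signed unit vectors, so a displacement with coordinates
   at most [(1 + C)^-1] costs weight at most 1. The added 1 keeps this radius positive when [C] is
   0. *)
pose C : R := \sum_k \sum_i (lp k i + lm k i).
have C0 : 0 <= C.
  apply: sumr_ge0 => i _; apply: sumr_ge0 => j _.
  apply: addr_ge0; [by case: (lpP i)|by case: (lmP i)].
have e0 : 0 < (1 + C)^-1 by rewrite invr_gt0 ltr_pwDl.
apply/nbhs_ballP; exists (1 + C)^-1 => //= y [_ yx].
pose w := y - x.
have we k : `|w 0 k| <= (1 + C)^-1.
  by apply: ltW; have := yx 0 k; rewrite /ball/= distrC !mxE.
pose q (k : 'I_d) i := if 0 <= w 0 k then lp k i else lm k i.
have q0 k i : 0 <= q k i.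
  by rewrite /q; case: ifP; [by case: (lpP k)|by case: (lmP k)].
have qE k : w 0 k *: delta_mx 0 k = \sum_i (`|w 0 k| * q k i) *: u i.
  rewrite /q; case: (boolP (0 <= w 0 k)) => wk.
    rewrite ger0_norm//; case: (lpP k) => _ ->; rewrite scaler_sumr.
    by apply: eq_bigr => i _; rewrite scalerA.
  rewrite ltr0_norm ?ltNge//.
  case: (lmP k) => _ lmk; rewrite -[delta_mx 0 k]opprK lmk.
  rewrite scalerN scaler_sumr -sumrN.
  by apply: eq_bigr => i _; rewrite scalerA mulNr scaleNr.
pose s i := \sum_k `|w 0 k| * q k i.
have s0 i : 0 <= s i by apply: sumr_ge0 => k _; rewrite mulr_ge0.
have wE : w = \sum_i s i *: u i.
  rewrite [LHS]row_sum_delta; under eq_bigr do rewrite qE.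
  by rewrite exchange_big; apply: eq_bigr => i _; rewrite scaler_suml.
have s1 : \sum_i s i <= 1.
  rewrite exchange_big/=; apply: (@le_trans _ _ ((1 + C)^-1 * C)).
    rewrite mulr_sumr; apply: ler_sum => k _; rewrite mulr_sumr.
    apply: ler_sum => i _; apply: ler_pM => //.
    rewrite /q; case: (lpP k) (lmP k) => [/(_ i) ? _] [/(_ i) ? _].
    by case: ifP => _; lra.
  by rewrite mulrC ler_pdivrMr ?mul1r ?lerDr ?ltr_pwDl.
(* Weight [s i] goes to the vertices directly; the remaining weight stays at [x] and is spread
   according to [r]. *)
exists (fun i => (1 - \sum_j s j) * r i + s i); split.
  by move=> i; rewrite addr_ge0// mulr_ge0// subr_ge0.
split; first by rewrite big_split/= -mulr_sumr r1; lra.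
have -> : y = x + w by rewrite addrC subrK.
under eq_bigr do rewrite scalerDl -scalerA.
rewrite big_split/= -scaler_sumr -xE wE scalerBl scale1r -addrA; congr (_ + _).
by rewrite scaler_suml addrC -sumrB; apply: eq_bigr => i _; rewrite scalerBr.
Qed.

End Farkas.

(** * Facets through boundary points *)

Lemma sub_in_count (T : eqType) (P Q : pred T) (s : seq T) :
  (forall x, x \in s -> P x -> Q x) -> (count P s <= count Q s)%N.
Proof.
move=> PQ; rewrite (@eq_in_count _ P (predI P Q)) => [|x xs /=].
  by apply: sub_count => x /andP[].
by case Px: (P x) => //=; rewrite PQ.
Qed.

Section Facets.
Variables (R : realType) (d : nat).
Implicit Types (a c x y : 'rV[R]_d) (S V : seq 'rV[R]_d).

Definition affmx S := \matrix_(i < size S) (S`_i - S`_0).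

(** Translates between the rank defining [affdim] and functionals constant on the points. *)
Lemma affmx_orth S c :
  affmx S *m c^T = 0 <-> {in S, forall v, dotp c v = dotp c S`_0}.
Proof.
have E i : (affmx S *m c^T) i 0 = dotp c S`_i - dotp c S`_0.
  rewrite -dotpBr mxE; apply: eq_bigr => j _.
  by rewrite !mxE mulrC.
split=> [M0 v vS|cS].
  have iS : (index v S < size S)%N by rewrite index_mem.
  have := E (Ordinal iS); rewrite M0 mxE /= nth_index// => /esym/eqP.
  by rewrite subr_eq0 => /eqP.
apply/matrixP => i j; rewrite ord1 E cS ?mem_nth// subrr.
by rewrite mxE.
Qed.

Lemma dotp_le_conv V x a b :
  Defs.conv V x -> (forall v, v \in V -> dotp a v <= b) -> dotp a x <= b.
Proof.
move=> [l [l0 [l1 ->]]] aV; rewrite dotp_sumr -[b]mul1r -l1 mulr_suml.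
by apply: ler_sum => i _; rewrite dotpZr ler_wpM2l//; apply/aV/mem_nth/ltn_ord.
Qed.

(** Complementary slackness: a convex combination attaining the maximum of [a] puts weight only on
    points where [a] is maximal. *)
Lemma dotp_conv_on_hyp V x a c k :
  Defs.conv V x -> (forall v, v \in V -> dotp a v <= dotp a x) ->
  {in on_hyp a (dotp a x) V, forall v, dotp c v = k} -> dotp c x = k.
Proof.
move=> [l [l0 [l1 xE]]] aV cT.
have lT i : l i != 0 -> dotp a V`_i = dotp a x.
  have /eqP : \sum_i l i * (dotp a x - dotp a V`_i) = 0.
    under eq_bigr do rewrite mulrBr.
    rewrite sumrB -mulr_suml l1 mul1r {1}xE dotp_sumr.
    by under eq_bigr do rewrite dotpZr; rewrite subrr.
  rewrite psumr_eq0 => [/allP h li|j _].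
    have := h i (mem_index_enum i); rewrite /= mulf_eq0 (negPf li) subr_eq0.
    by move=> /eqP.
  by rewrite mulr_ge0// subr_ge0; apply/aV/mem_nth/ltn_ord.
rewrite xE dotp_sumr -[k]mul1r -l1 mulr_suml; apply: eq_bigr => i _.
rewrite dotpZr; have [->|li] := eqVneq (l i) 0; first by rewrite !mul0r.
by rewrite cT// mem_filter lT// eqxx; apply/mem_nth/ltn_ord.
Qed.

Lemma conv_on_hyp_neq0 V x a :
  Defs.conv V x -> (forall v, v \in V -> dotp a v <= dotp a x) ->
  on_hyp a (dotp a x) V != [::].
Proof.
move=> Vx aV; apply/eqP => T0.
(* With no point on the hyperplane, [dotp a x] would equal every [k]. *)
have h k : dotp a x = k by apply: (dotp_conv_on_hyp (k := k) Vx aV); rewrite T0.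
by have := h (dotp a x + 1); lra.
Qed.

Lemma full_dim_const V c k :
  full_dim V -> {in V, forall v, dotp c v = k} -> c = 0.
Proof.
move=> [V0 rV] cV.
have /affmx_orth M0 : {in V, forall v, dotp c v = dotp c V`_0}.
  by move=> v vV; rewrite !cV// mem_nth// lt0n size_eq0.
have full : row_full (affmx V) by rewrite /row_full; apply/eqP.
have : affmx V *m c^T = affmx V *m 0 by rewrite M0 mulmx0.
by move=> /(row_full_inj full)/(congr1 trmx); rewrite trmxK trmx0.
Qed.

Lemma affdim_on_hyp_lt V a b : a != 0 -> (affdim (on_hyp a b V) < d)%N.
Proof.
move=> a0; rewrite ltn_neqAle rank_leq_col andbT.
apply/negP => full; case/eqP: a0.
have /affmx_orth M0 :
  {in on_hyp a b V, forall v, dotp a v = dotp a (on_hyp a b V)`_0}.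
  move=> v vT; have v0 : (on_hyp a b V)`_0 \in on_hyp a b V.
    by rewrite mem_nth//; case: (on_hyp _ _ _) vT.
  by move: vT v0; rewrite !mem_filter => /andP[/eqP-> _] /andP[/eqP-> _].
have : affmx (on_hyp a b V) *m a^T = affmx (on_hyp a b V) *m 0.
  by rewrite M0 mulmx0.
by move=> /(row_full_inj full)/(congr1 trmx); rewrite trmxK trmx0.
Qed.

(** The functionals constant on [S] form a space of dimension at least 2, too large for the line
    spanned by [a]. *)
Lemma orth_not_parallel S a : (affdim S < d.-1)%N ->
  exists2 c, ~~ (c <= a)%MS & {in S, forall v, dotp c v = dotp c S`_0}.
Proof.
rewrite /affdim -/(affmx S) => rS.
have /row_subPn[i ic] : ~~ (kermx (affmx S)^T <= a)%MS.
  apply/negP => /mxrankS; rewrite mxrank_ker mxrank_tr => rk.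
  by have := leq_trans rk (rank_leq_row a); lia.
exists (row i (kermx (affmx S)^T)) => //.
apply/affmx_orth; apply: trmx_inj.
by rewrite trmx_mul trmxK -row_mul mulmx_ker !(row0, trmx0).
Qed.

(** A supporting hyperplane at [x] that is not a facet hyperplane can be tilted to contain strictly
    more points of [V]; the induction is on the number of points off it. *)
Lemma facet_through V x a :
  full_dim V -> Defs.conv V x -> a != 0 ->
  (forall v, v \in V -> dotp a v <= dotp a x) ->
  exists a', facet_hyp a' (dotp a' x) V.
Proof.
move=> fV Vx.
have [n] := ubnP (size V - size (on_hyp a (dotp a x) V)).
elim: n a => // n IHn a szn a0 aV.
have T0 := conv_on_hyp_neq0 Vx aV.
have := affdim_on_hyp_lt V (dotp a x) a0.
set T := on_hyp a (dotp a x) V in szn T0 * => rd.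
have [rT|rT] := leqP d.-1 (affdim T).
  exists a; split=> //; split=> //; split=> //.
  by apply/eqP; rewrite eqn_leq rT andbT -ltnS (leq_trans rd)// leqSpred.
(* Rotate [a] around the affine hull of [T] until it meets a new vertex. *)
have {rT}[c [ca [v vV cv] cT]] : exists c, [/\ ~~ (c <= a)%MS,
    (exists2 v, v \in V & dotp c x < dotp c v) &
    {in T, forall v, dotp c v = dotp c x}].
  have [c ca cT] := orth_not_parallel a rT.
  have cx : dotp c x = dotp c T`_0 by exact: dotp_conv_on_hyp Vx aV cT.
  rewrite -cx in cT.
  have [[v vV vc]|nov] := pselect (exists2 v, v \in V & dotp c x < dotp c v).
    by exists c; split=> //; exists v.
  (* If neither [c] nor [- c] exceeded its value at [x] somewhere on [V], then [c] would be constant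
     on [V], hence zero by full dimension. *)
  exists (- c); split; first by rewrite eqmx_opp.
    apply: contrapT => nov'; case/negP: ca.
    rewrite (@full_dim_const V c (dotp c x)) ?sub0mx// => v vV.
    apply/eqP; rewrite eq_le; apply/andP; split; rewrite leNgt; apply/negP => h.
      by apply: nov; exists v.
    apply: nov'; exists v => //.
    by rewrite !dotpNl ltrN2.
  by move=> v vT; rewrite !dotpNl cT.
have iV : (index v V < size V)%N by rewrite index_mem.
pose P (i : 'I_(size V)) := dotp c x < dotp c V`_i.
(* [F i] is the tilt at which the hyperplane reaches point [i]; the least one keeps all of [V] on
   one side. *)
pose F (i : 'I_(size V)) := (dotp a x - dotp a V`_i) / (dotp c V`_i - dotp c x).
have [|j Pj Fj] := @arg_minP _ _ _ (Ordinal iV) P F; first by rewrite /P/= nth_index.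
set t := F j in Fj.
have vjV : V`_j \in V by rewrite mem_nth.
have t0 : 0 <= t by rewrite divr_ge0 ?subr_ge0 ?aV ?ltW.
pose a' := a + t *: c.
have a'E w : dotp a' w = dotp a w + t * dotp c w by rewrite dotpDl dotpZl.
have a'V w : w \in V -> dotp a' w <= dotp a' x.
  move=> wV; rewrite !a'E -subr_ge0 opprD addrACA -mulrBr.
  have [wc|wc] := leP (dotp c w) (dotp c x).
    by apply: addr_ge0; [rewrite subr_ge0 aV|rewrite mulr_ge0// subr_ge0].
  have iw : (index w V < size V)%N by rewrite index_mem.
  have := Fj (Ordinal iw); rewrite /P /F/= nth_index// => /(_ wc).
  by rewrite ler_pdivlMr ?subr_gt0// -[_ - dotp c w]opprB mulrN subr_ge0.
have a'j : dotp a' V`_j = dotp a' x.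
  apply/eqP; rewrite !a'E eq_sym -subr_eq0 opprD addrACA -mulrBr.
  by rewrite -[_ - dotp c _]opprB mulrN /t /F divfK ?subrr// gt_eqF// subr_gt0.
apply: (IHn a') => //.
  suff : (size T < size (on_hyp a' (dotp a' x) V))%N.
    have : (size (on_hyp a' (dotp a' x) V) <= size V)%N.
      by rewrite size_filter count_size.
    by move: szn; lia.
  rewrite !size_filter.
  (* The points of [T] stay on the tilted hyperplane, since [c] is constant on them, and point [j]
     is new, since [c] is larger there. *)
  have := count_predUI (fun w => dotp a w == dotp a x) (pred1 V`_j) V.
  rewrite (@eq_count _ (predI _ _) pred0) => [|w /=]; last first.
    apply/negbTE/negP => /andP[/eqP aw /eqP wj].
    have := cT w; rewrite mem_filter aw eqxx wj vjV => /(_ isT) h.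
    by move: Pj; rewrite /P h ltxx.
  rewrite count_pred0 addn0 => cU.
  apply: (@leq_trans (count (predU (fun w => dotp a w == dotp a x)
                                   (pred1 (V`_j)%R)) V)).
    by rewrite cU -addn1 leq_add2l -has_count has_pred1.
  apply: sub_in_count => w wV /= /orP[aw|/eqP ->]; last by rewrite a'j.
  by rewrite !a'E (eqP aw) cT// mem_filter aw.
(* If [a'] were zero, then [a] would be zero or [c] a multiple of [a]. *)
apply: contra ca => /eqP a'0.
have [t00|tn0] := eqVneq t 0.
  by case/eqP: a0; rewrite -a'0 /a' t00 scale0r addr0.
move/eqP: a'0; rewrite /a' addrC addr_eq0 => /eqP tc.
by rewrite -[c](scalerK tn0) tc scalemx_sub// eqmx_opp.
Qed.

End Facets.

(** * Affine independence on facets *)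

(** The kernel of [affmx S] is a line, spanned by the first unit vector because the first row is
    zero; a multiple of that vector with coordinate sum 0 vanishes. *)
Lemma aff_indep_eq0 (R : realType) (d : nat) (S : seq 'rV[R]_d)
    (mu : 'rV[R]_(size S)) :
  aff_indep S -> \sum_i mu 0 i = 0 -> \sum_i mu 0 i *: S`_i = 0 -> mu = 0.
Proof.
move=> [S0 rS] mu1 muS; have szS : (0 < size S)%N by rewrite lt0n size_eq0.
pose e : 'rV[R]_(size S) := delta_mx 0 (Ordinal szS).
have eker : (e <= kermx (affmx S))%MS.
  by apply/sub_kermxP; rewrite -rowE; apply/rowP => j; rewrite !mxE subrr.
have muker : (mu <= kermx (affmx S))%MS.
  apply/sub_kermxP; rewrite mulmx_sum_row.
  rewrite (eq_bigr (fun i => mu 0 i *: S`_i - mu 0 i *: S`_0)) => [|i _].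
    by rewrite sumrB muS -scaler_suml mu1 scale0r subrr.
  by rewrite -scalerBr; congr (_ *: _); apply/rowP => j; rewrite !mxE.
have rker : \rank (kermx (affmx S)) = 1%N.
  rewrite mxrank_ker; have -> : \rank (affmx S) = (size S).-1 by [].
  by rewrite -{1}(prednK szS) subSnn.
have := mxrank_leqif_sup eker; rewrite mxrank_delta rker => -[_ /esym].
rewrite eqxx => kere; have /sub_rVP[k muE] := submx_trans muker kere.
rewrite muE; suff -> : k = 0 by rewrite scale0r.
move: mu1; rewrite muE (bigD1 (Ordinal szS))//= big1 => [|i iS].
  by rewrite !mxE !eqxx mulr1 addr0.
by rewrite !mxE (negPf iS) andbF mulr0.
Qed.

Section FacetFree.
Variables (R : realType) (d : nat) (V : seq 'rV[R]_d).

(* For each facet hyperplane, the points [p i] on it are affinely independent as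
   an indexed family, so repetitions are excluded. *)
Definition facet_free n (p : 'I_n -> 'rV[R]_d) := forall a b, facet_hyp a b V ->
  forall mu : 'I_n -> R, (forall i, dotp a (p i) != b -> mu i = 0) ->
  \sum_i mu i = 0 -> \sum_i mu i *: p i = 0 -> forall i, mu i = 0.

Lemma simplicial_facet_free : uniq V -> simplicial V ->
  facet_free (fun i : 'I_(size V) => V`_i).
Proof.
move=> uV sV a b ab mu muT mu1 muV i; set T := on_hyp a b V.
(* [nu] carries the weights from indices to points, which is consistent because [V] has no
   repetition; this lets sums over [T] and over [V] be compared. *)
pose nu v := oapp mu 0 (insub (index v V)).
have nuE (j : 'I_(size V)) : nu V`_j = mu j by rewrite /nu index_uniq// valK.
have sumT (M : nmodType) (F : 'rV[R]_d -> M) :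
    (forall v, v \in V -> nu v = 0 -> F v = 0) ->
    \sum_(j < size T) F T`_j = \sum_(j < size V) F V`_j.
  move=> F0; rewrite -(big_mkord xpredT (fun j => F T`_j)) -(big_nth 0 xpredT F).
  rewrite -(big_mkord xpredT (fun j => F V`_j)) -(big_nth 0 xpredT F) big_filter.
  rewrite big_seq_cond [RHS]big_seq_cond big_mkcond [RHS]big_mkcond.
  apply: eq_bigr => v _; rewrite andbT; case: (boolP (v \in V)) => //= vV.
  case: ifPn => // vT; rewrite F0//.
  have iV : (index v V < size V)%N by rewrite index_mem.
  have := nuE (Ordinal iV); rewrite /= nth_index// => ->.
  by apply: muT; rewrite /= nth_index.
have : \row_(j < size T) nu T`_j = 0.
  apply: aff_indep_eq0; first exact: sV ab.
    by under eq_bigr do rewrite mxE; rewrite sumT// -[RHS]mu1; apply: eq_bigr.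
  under eq_bigr do rewrite mxE.
  rewrite (sumT _ (fun v => nu v *: v)) => [|v _ ->]; last by rewrite scale0r.
  by rewrite -[RHS]muV; apply: eq_bigr => j _; rewrite nuE.
have [iT|/muT//] := eqVneq (dotp a V`_i) b.
have viT : V`_i \in T by rewrite mem_filter iT eqxx mem_nth.
have idx : (index (V`_i)%R T < size T)%N by rewrite index_mem.
by move=> /rowP/(_ (Ordinal idx)); rewrite !mxE /= nth_index// nuE.
Qed.

Lemma sum_delta (n : nat) (p : 'I_n -> 'rV[R]_d) (j : 'I_n) :
  \sum_k (k == j)%:R *: p k = p j.
Proof.
rewrite (bigD1 j)//= eqxx scale1r big1 ?addr0// => k /negPf->.
by rewrite scale0r.
Qed.

Lemma sum_eq_ord (n : nat) (j : 'I_n) : \sum_(k < n) (k == j)%:R = 1 :> R.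
Proof. by rewrite (bigD1 j)//= eqxx big1 ?addr0// => k /negPf->. Qed.

(** A coincidence would be a dependency with weights 1 and -1. *)
Lemma facet_free_neq n (p : 'I_n -> 'rV[R]_d) a b i j :
  facet_free p -> facet_hyp a b V -> dotp a (p i) = b -> dotp a (p j) = b ->
  i != j -> p i != p j.
Proof.
move=> fp ab pi pj ij; apply/negP => /eqP pij.
pose mu k : R := (k == i)%:R - (k == j)%:R.
suff /(_ i)/eqP : forall k, mu k = 0.
  by rewrite /mu eqxx (negPf ij) subr0 oner_eq0.
apply: (fp a b ab) => [k kb||]; rewrite /mu.
- have /negPf-> : k != i by apply: contraNneq kb => ->; rewrite pi.
  have /negPf-> : k != j by apply: contraNneq kb => ->; rewrite pj.
  by rewrite subrr.
- by rewrite sumrB !sum_eq_ord subrr.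
- under eq_bigr do rewrite scalerBl.
  by rewrite sumrB !sum_delta pij subrr.
Qed.

(** A facet containing the midpoint contains both endpoints, so the weight of the midpoint can be
    shared equally between them without leaving the facet. *)
Lemma facet_free_midpoint n (p : 'I_n -> 'rV[R]_d) i j :
  facet_free p -> (forall k, Defs.conv V (p k)) -> i != j ->
  facet_free (fun k => if k == i then 2^-1 *: (p i + p j) else p k).
Proof.
move=> fp Vp ij a b ab mu muT mu1 muq.
have [_ [aV _]] := ab.
have le k : dotp a (p k) <= b by exact: dotp_le_conv (Vp k) aV.
have tight : mu i != 0 -> dotp a (p i) = b /\ dotp a (p j) = b.
  move=> mui; have : dotp a (2^-1 *: (p i + p j)) = b.
    by apply/eqP; apply: contra_neqT mui => h; apply: muT; rewrite eqxx.
  rewrite dotpZr dotpDr => E; have := le i; have := le j.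
  by split; lra.
(* A dependency of the new points pulls back to one of the old points. *)
pose nu k := mu k + (mu i / 2) * ((k == j)%:R - (k == i)%:R).
have nu0 : forall k, nu k = 0.
  apply: (fp a b ab) => [k kb||].
  - rewrite /nu; have [mui|/tight[pi pj]] := eqVneq (mu i) 0.
      rewrite mui !mul0r addr0; have [->//|ki] := eqVneq k i.
      by apply: muT; rewrite (negPf ki).
    have ki : k != i by apply: contraNneq kb => ->; rewrite pi.
    have kj : k != j by apply: contraNneq kb => ->; rewrite pj.
    by rewrite (negPf ki) (negPf kj) subrr mulr0 addr0 muT// (negPf ki).
  - by rewrite big_split/= mu1 -mulr_sumr sumrB !sum_eq_ord subrr mulr0 addr0.
  - rewrite -[RHS]muq /nu.
    rewrite (eq_bigr (fun k => mu k *: p k + (mu i / 2) *: ((k == j)%:R *: p k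
       - (k == i)%:R *: p k))) => [|k _]; last first.
      by rewrite scalerDl -scalerA scalerBl.
    rewrite big_split/= -scaler_sumr sumrB !sum_delta.
    rewrite (bigD1 i)//= [RHS](bigD1 i)//= eqxx addrAC; congr (_ + _); last first.
      by apply: eq_bigr => k /negPf->.
    by apply/rowP => l; rewrite !mxE; field.
have mui : mu i = 0.
  by have := nu0 i; rewrite /nu eqxx (negPf ij) /= mulr0n; lra.
by move=> k; have := nu0 k; rewrite /nu mui !mul0r addr0.
Qed.

End FacetFree.

(** * Lattice midpoints and the descent *)

Lemma conv_vertex (R : realType) (d : nat) (V : seq 'rV[R]_d) (i : 'I_(size V)) :
  Defs.conv V V`_i.
Proof.
exists (fun k => (k == i)%:R); split; first by move=> k; rewrite ler0n.
by split; [rewrite sum_eq_ord | rewrite (sum_delta (fun k => V`_k))].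
Qed.

Lemma conv_midpoint (R : realType) (d : nat) (V : seq 'rV[R]_d) x y :
  Defs.conv V x -> Defs.conv V y -> Defs.conv V (2^-1 *: (x + y)).
Proof.
move=> [l [l0 [l1 ->]]] [m [m0 [m1 ->]]].
exists (fun k => 2^-1 * (l k + m k)); split.
  by move=> k; rewrite mulr_ge0 ?invr_ge0 ?addr_ge0.
split; first by rewrite -mulr_sumr big_split/= l1 m1; lra.
rewrite -big_split/= scaler_sumr; apply: eq_bigr => k _.
by rewrite -scalerDl scalerA.
Qed.

Definition sqlen d (z : 'rV[int]_d) : nat := (\sum_k `|z 0%R k| ^ 2)%N.

(** Parallelogram law: four times the squared length of [m], plus the positive squared length of
    [z - w], is twice the sum of those of [z] and [w]. *)
Lemma sqlen_midpoint d (z w m : 'rV[int]_d) :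
  m + m = z + w -> z != w -> (sqlen w <= sqlen z)%N -> (sqlen m < sqlen z)%N.
Proof.
move=> mE zw wz.
have E (x : 'rV[int]_d) : (sqlen x)%:Z = \sum_k x 0 k ^+ 2.
  rewrite /sqlen -natz natr_sum; apply: eq_bigr => k _.
  by rewrite natz -mulnn PoszM abszE -expr2 real_normK ?num_real.
have par : 4 * (sqlen m)%:Z + \sum_k (z 0 k - w 0 k) ^+ 2 =
    2 * (sqlen z)%:Z + 2 * (sqlen w)%:Z.
  rewrite !E !mulr_sumr -!big_split; apply: eq_bigr => k _ /=.
  move/rowP/(_ k): mE; rewrite !mxE => mE.
  have -> : 4 * m 0 k ^+ 2 = (m 0 k + m 0 k) ^+ 2 by ring.
  by rewrite mE; ring.
have : 0 < \sum_k (z 0 k - w 0 k) ^+ 2.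
  rewrite lt_neqAle sumr_ge0 ?andbT => [|k _]; last exact: sqr_ge0.
  apply: contraNneq zw => /esym/eqP.
  rewrite psumr_eq0 => [/allP h|k _]; last exact: sqr_ge0.
  apply/eqP/rowP => k; have := h k (mem_index_enum k).
  by rewrite /= sqrf_eq0 subr_eq0 => /eqP.
by move: par wz; set s := \sum_k _; lia.
Qed.

Lemma same_parity_midpoint d (z w : 'rV[int]_d) :
  (forall k, odd `|z 0%R k| = odd `|w 0%R k|) -> exists m, m + m = z + w.
Proof.
move=> zw; exists (\row_k ((z 0%R k + w 0%R k)%R %/ 2)%Z); apply/rowP => k.
by rewrite !mxE; move: (z 0 k) (w 0 k) (zw k) => x y; lia.
Qed.

(** The family [p] is not restricted to vertices, because the induction replaces points by
    midpoints. *)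
Lemma facet_free_lattice_card (R : realType) (d : nat) (V : seq 'rV[R]_d)
    (n : nat) (p : 'I_n -> 'rV[int]_d) :
  full_dim V -> hollow V ->
  facet_free V (fun i => map_mx intr (p i)) ->
  (forall i, Defs.conv V (map_mx intr (p i))) ->
  (n <= 2 ^ d)%N.
Proof.
move=> fV hV; have [N] := ubnP (\sum_i sqlen (p i))%N.
elim: N p => // N IHN p pN fp Vp.
(* [f] is reduction modulo 2, with [2 ^ d] possible values. *)
pose f (i : 'I_n) := [ffun k : 'I_d => odd `|p i 0%R k|].
have [/leq_card|/injectivePn[i0 [j0 ij0 fij0]]] := altP (injectiveP f).
  by rewrite card_ffun card_bool !card_ord.
have [i [j [ij fij ji]]] :
    exists i j, [/\ i != j, f i = f j & (sqlen (p j) <= sqlen (p i))%N].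
  case: (leqP (sqlen (p j0)) (sqlen (p i0))) => [?|/ltnW ?].
    by exists i0, j0.
  by exists j0, i0; rewrite eq_sym.
have [m mE] : exists m, m + m = p i + p j.
  by apply: same_parity_midpoint => k; move/ffunP/(_ k): fij; rewrite !ffunE.
pose P k : 'rV[R]_d := map_mx intr (p k).
have mP : map_mx intr m = 2^-1 *: (P i + P j).
  apply/rowP => k; move/rowP/(_ k)/(congr1 (intr : int -> R)): mE.
  by rewrite !mxE !rmorphD/=; lra.
have Vm : Defs.conv V (map_mx intr m).
  by rewrite mP; exact: conv_midpoint (Vp i) (Vp j).
have [a a0 aV] := supporting_hyperplane Vm (@hV m).
have [{a0 aV}a' ab] := facet_through fV Vm a0 aV.
(* Needed for the strict decrease: [m] maximizes [a'] on the polytope, hence so do both endpoints,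
   and independence on this facet separates them. *)
have pij : p i != p j.
  have [_ [aV _]] := ab.
  have [pi pj] := (dotp_le_conv (Vp i) aV, dotp_le_conv (Vp j) aV).
  have am : dotp a' (map_mx intr m) = 2^-1 * (dotp a' (P i) + dotp a' (P j)).
    by rewrite mP dotpZr dotpDr.
  have : P i != P j.
    by apply: (facet_free_neq fp ab) ij; rewrite -/(P _) in pi pj *; lra.
  by apply: contra_neq => e; rewrite /P e.
pose q k := if k == i then m else p k.
have qE k : map_mx intr (q k) = if k == i then 2^-1 *: (P i + P j) else P k.
  by rewrite /q -mP; case: ifP.
apply: (IHN q).
- rewrite ltnS in pN; apply: leq_trans pN.
  rewrite (bigD1 i)//= [X in (_ < X)%N](bigD1 i)//= /q eqxx.
  rewrite (eq_bigr (fun k => sqlen (p k))) => [|k /negPf-> //].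
  by rewrite ltn_add2r (sqlen_midpoint mE).
- have -> : (fun k => map_mx intr (q k)) =
      (fun k => if k == i then 2^-1 *: (P i + P j) else P k) by apply/funext.
  exact: facet_free_midpoint.
- by move=> k; rewrite /q; case: ifP.
Qed.

Theorem theorem2p2 (R : realType) (d : nat) (W : seq 'rV[int]_d) :
  (1 <= d)%N ->
  is_vertex_list (lattice_pts R W) ->
  full_dim (lattice_pts R W) ->
  simplicial (lattice_pts R W) ->
  hollow (lattice_pts R W) ->
  (size W <= 2 ^ d)%N.
Proof.
move=> _ [uW _] fW sW hW.
have <- : size (lattice_pts R W) = size W by rewrite size_map.
have E (i : 'I_(size (lattice_pts R W))) : map_mx intr W`_i = (lattice_pts R W)`_i.
  by rewrite (nth_map 0)// -(size_map (map_mx (intr : int -> R))).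
apply: (@facet_free_lattice_card _ _ _ _ (fun i => W`_i) fW hW).
  have -> : (fun i : 'I_(size (lattice_pts R W)) => map_mx intr W`_i) =
      (fun i => (lattice_pts R W)`_i) by apply/funext.
  exact: simplicial_facet_free.
by move=> i; rewrite E; exact: conv_vertex.
Qed.
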